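(* Let $\varphi:\mathbb{R}_+\to\mathbb{R}_+$ be a strictly convex differentiable admissible function, and let $f:X\to\mathbb{R}\cup\{+\infty\}$ be a proper lower semicontinuous function on a Banach space $X$. Suppose that $f$ has $\varphi$-SLWP at $\bar x\in{\rm dom}(f)$. Then there exists $r>0$ such that $\partial\,\overline{\rm co}(f+\delta_{B_X[\bar x,r]})$ is strongly metrically $\varphi'$-regular at $(\bar x,0)$.
   Context: $\mathbb{R}_+=[0,+\infty)$; $B_X(x,r)$ and $B_X[x,r]$ are the open and closed balls; ${\rm dom}(f)=\{x: f(x)<+\infty\}$; $X^*$ is the dual of $X$, and $f_{u^*}(x):=f(x)-\langle u^*,x\rangle$. $\delta_A$ is the indicator function of $A$ ($0$ on $A$, $+\infty$ elsewhere). Admissible function: a nondecreasing $\varphi:\mathbb{R}_+\to\mathbb{R}_+$ with $\varphi(0)=0$ such that $\varphi(t)\to0$ implies $t\to0$. The derivative at $0$ is the right derivative. $\varphi$-SLWP (stable local well-posedness with respect to $\varphi$) of $f$ at $\bar x\in{\rm dom}(f)$: there exist $\delta,r,\tau,\kappa\in(0,+\infty)$ such that for every $u^*\in B_{X^*}(0,\delta)$ there is $x_{u^*}\in B_X[\bar x,r]$, with $x_0=\bar x$, satisfying $\varphi(\kappa\|x-x_{u^*}\|)\le\tau(f_{u^*}(x)-f_{u^*}(x_{u^*}))$ for all $x\in B_X[\bar x,r]$. For a proper lower semicontinuous $g$ bounded below on $X$, $\overline{\rm co}\,g$ is the (closed) convex envelope: ${\rm epi}(\overline{\rm co}\,g)=\overline{\rm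 co}({\rm epi}(g))$; it is proper, lower semicontinuous and convex. For a proper convex $h$, $\partial h(x)=\{x^*\in X^*:\langle x^*,y-x\rangle\le h(y)-h(x)\ \forall y\in X\}$ for $x\in{\rm dom}(h)$, and $\partial h(x)=\emptyset$ otherwise. Metric regularity: let $\psi:\mathbb{R}_+\to\mathbb{R}_+$ be an admissible function and $F:X\rightrightarrows Y$ a multifunction between Banach spaces, $(\bar x,\bar y)\in{\rm gph}(F)=\{(x,y): y\in F(x)\}$, $F^{-1}(y)=\{x: y\in F(x)\}$. $F$ is strongly metrically $\psi$-regular at $(\bar x,\bar y)$ if there exist $r,\tau,\kappa,\delta\in(0,+\infty)$ such that $\psi(\tau d(x,F^{-1}(y)))\le\kappa d(y,F(x))$ for all $(x,y)\in B_X(\bar x,r)\times B_Y(\bar y,r)$ and $F^{-1}(y)\cap B_X(\bar x,\delta)$ is a singleton for all $y\in B_Y(\bar y,r)$. This notion is applied here with $\psi=\varphi'$. Here $d(x,A)=\inf_{a\in A}\|x-a\|$, $d(x,\emptyset)=+\infty$, and $\psi(+\infty):=\lim_{t\to+\infty}\psi(t)$.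
   Formalization: The formal theorem additionally assumes φ'(0)=0, which admissibility of φ' requires; without it the claim is false, e.g. φ(t)=t+t², f=|x| on the real line, x̄=0. *)

(* Defs.v *)
From HB Require Import structures.
From mathcomp Require Import all_boot all_order all_algebra.
From mathcomp Require Import all_classical all_reals all_analysis.

Set Implicit Arguments.
Unset Strict Implicit.
Unset Printing Implicit Defensive.
Import Order.TTheory GRing.Theory Num.Theory.
Import numFieldNormedType.Exports.
Local Open Scope classical_set_scope.
Local Open Scope ring_scope.

Section dual_space.
Context {R : realType} {X : normedModType R}.

Definition continuous_linear : {pred X -> R^o} :=
  fun f => `[< linear f /\ continuous f >].

Lemma continuous_linear_submod : submod_closed continuous_linear.
Proof.
split=> [|a f g /asboolP[lf cf] /asboolP[lg cg]]; apply/asboolP; split.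
- by move=> a x y /=; rewrite /GRing.zero/= scaler0 addr0.
- by move=> x; exact: cvg_cst.
- move=> b x y.
  rewrite -[LHS]/(a *: f (b *: x + y) + g (b *: x + y)) lf lg.
  rewrite -[RHS]/(b *: (a *: f x + g x) + (a *: f y + g y)).
  by rewrite !scalerDr !scalerA (mulrC a b) addrACA.
- move=> x; apply: (@cvgD _ _ _ _ _ (a *: f) g); last exact: cg.
  by exact: (@cvgZl_tmp _ _ _ _ _ a f _ (cf x)).
Qed.

HB.instance Definition _ :=
  GRing.isSubmodClosed.Build R (X -> R^o) continuous_linear
    continuous_linear_submod.

End dual_space.
Arguments continuous_linear {R} X.

Record dual (R : realType) (X : normedModType R) :=
  Dual { dual_fun :> X -> R^o ; _ : dual_fun \in continuous_linear X }.

Section dual_normed.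
Context {R : realType} {X : normedModType R}.

HB.instance Definition _ := [isSub for @dual_fun R X].
HB.instance Definition _ := [Choice of dual X by <:].
HB.instance Definition _ := [SubChoice_isSubLmodule of dual X by <:].

Implicit Types (u v : dual X) (x y : X).

Lemma dual_ext u v : (forall x, u x = v x) -> u = v.
Proof. by move=> uv; apply/val_inj/funext. Qed.

Lemma dualP u : linear u /\ continuous u.
Proof. by case: u => f /= /asboolP. Qed.

HB.instance Definition _ u :=
  GRing.isLinear.Build R X R^o *:%R u (dualP u).1.

Lemma dual_addE u v x : (u + v) x = u x + v x. Proof. by []. Qed.
Lemma dual_oppE u x : (- u) x = - u x. Proof. by []. Qed.
Lemma dual_scaleE a u x : (a *: u) x = a * u x. Proof. by []. Qed.
Lemma dual_zeroE x : (0 : dual X) x = 0. Proof. by []. Qed.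

Definition dual_norm u : R := sup [set `|u x| | x in [set x | `|x| <= 1]].

Lemma dual_norm_has_sup u : has_sup [set `|u x| | x in [set x | `|x| <= 1]].
Proof.
split; first by exists `|u 0|, 0 => //=; rewrite normr0.
have /linear_bounded_continuous/bounded_funP/(_ 1)[M hM] := (dualP u).2.
by exists M => _ [x /= x1 <-]; exact: hM.
Qed.

Lemma dual_norm_ge u x : `|x| <= 1 -> `|u x| <= dual_norm u.
Proof.
by move=> x1; apply: (sup_upper_bound (dual_norm_has_sup u)); exists x.
Qed.

Lemma dual_norm_le u M : (forall x, `|x| <= 1 -> `|u x| <= M) ->
  dual_norm u <= M.
Proof.
move=> uM; apply: ge_sup; first by case: (dual_norm_has_sup u).
by move=> _ [x /= x1 <-]; exact: uM.
Qed.

Lemma dual_le u x : `|u x| <= dual_norm u * `|x|.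
Proof.
have [->|x0] := eqVneq x 0; first by rewrite linear0 !normr0 mulr0.
have nx : 0 < `|x| by rewrite normr_gt0.
rewrite -ler_pdivrMr//.
have -> : `|u x| / `|x| = `|u (`|x|^-1 *: x)|.
  by rewrite linearZ/= normrM normfV normr_id mulrC.
by apply: dual_norm_ge; rewrite normrZ normfV normr_id mulVf// gt_eqF.
Qed.

Lemma dual_normD u v : dual_norm (u + v) <= dual_norm u + dual_norm v.
Proof.
apply: dual_norm_le => x x1; rewrite dual_addE (le_trans (ler_normD _ _))//.
by apply: lerD; exact: dual_norm_ge.
Qed.

Lemma dual_normZ (a : R) u : dual_norm (a *: u) = `|a| * dual_norm u.
Proof.
have le b w : dual_norm (b *: w) <= `|b| * dual_norm w.
  apply: dual_norm_le => x x1; rewrite dual_scaleE normrM.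
  by rewrite ler_wpM2l// dual_norm_ge.
apply/eqP; rewrite eq_le le/=.
have [->|a0] := eqVneq a 0.
  rewrite normr0 mul0r (le_trans (normr_ge0 ((0 *: u) 0)))//.
  by rewrite dual_norm_ge// normr0.
have := le a^-1 (a *: u); rewrite scalerA mulVf// scale1r normfV.
by rewrite ler_pdivlMl// normr_gt0.
Qed.

Lemma dual_norm0_eq0 u : dual_norm u = 0 -> u = 0.
Proof.
move=> u0; apply: dual_ext => x; apply/normr0_eq0/eqP.
by rewrite eq_le normr_ge0 andbT (le_trans (dual_le u x))// u0 mul0r.
Qed.

HB.instance Definition _ := Lmodule_isNormed.Build R (dual X)
  dual_normD dual_normZ dual_norm0_eq0.

Lemma dual_normE u : `|u| = dual_norm u. Proof. by []. Qed.

End dual_normed.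

Section dual_complete.
Context {R : realType} {X : normedModType R}.

Lemma dual_complete (F : set_system (dual X)) :
  ProperFilter F -> cauchy F -> cvg F.
Proof.
move=> PF /cauchyP cF.
have {}cF e : 0 < e -> exists u : dual X, \forall v \near F, `|u - v| <= e.
  move=> e0; have [u Fu] := cF _ e0; exists u; apply: filterS Fu => v.
  by rewrite -ball_normE => /ltW.
have cFx x : cvg ((fun u : dual X => u x) @ F).
  apply: cauchy_cvg; apply: cauchy_exP => e e0.
  have d0 : 0 < e / 2 / (`|x| + 1) by rewrite !divr_gt0// ltr_wpDl.
  have [u Fu] := cF _ d0; exists (u x).
  apply: filterS Fu => v uv; rewrite -ball_normE /ball_/=.
  rewrite -[u x - v x]/((u - v) x) (le_lt_trans (dual_le _ _))// -dual_normE.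
  rewrite (@le_lt_trans _ _ (e / 2))//; last first.
    by rewrite ltr_pdivrMr// ltr_pMr// ltr1n.
  rewrite -(ler_pM2r (x := (`|x| + 1)^-1)) ?invr_gt0 ?ltr_wpDl//.
  apply: le_trans uv; rewrite -mulrA ler_piMr// ler_pdivrMr ?ltr_wpDl//.
  by rewrite mul1r lerDl.
pose l (x : X) : R^o := lim ((fun u : dual X => u x) @ F).
have ll : linear l.
  move=> a x y; apply: cvg_lim => //=.
  rewrite (_ : (fun u : dual X => _) = (fun u => a *: (u x : R^o) + u y)).
    by apply: cvgD; [apply: cvgZl_tmp; exact: cFx|exact: cFx].
  by apply/funext => u; rewrite linearP.
have lle (u : dual X) e x : (\forall v \near F, `|u - v| <= e) ->
    `|u x - l x| <= e * `|x|.
  move=> Fu.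
  have cn : (fun v : dual X => `|u x - v x|) @ F --> `|u x - l x|.
    by apply: cvg_norm; apply: cvgB; [exact: cvg_cst|exact: cFx].
  rewrite -(cvg_lim _ cn)//; apply: limr_le.
    by apply/cvg_ex; exists `|u x - l x|.
  apply: filterS Fu => v uv.
  rewrite -[u x - v x]/((u - v) x) (le_trans (dual_le _ _))// -dual_normE.
  by rewrite ler_wpM2r.
pose L0 : {linear X -> R^o} := HB.pack l (GRing.isLinear.Build _ _ _ _ l ll).
have lc : continuous l.
  apply: (@bounded_linear_continuous _ _ _ L0); apply/bounded_funP => r.
  have [u Fu] := cF 1 ltr01; exists ((`|u| + 1) * r) => x xr.
  rewrite (@le_trans _ _ ((`|u| + 1) * `|x|))//; last first.
    by rewrite ler_wpM2l// addr_ge0.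
  rewrite -[L0 x]/(l x) -[l x](subKr (u x)) (le_trans (ler_normB _ _))//.
  by rewrite mulrDl lerD// ?lle// dual_normE dual_le.
have lP : l \in continuous_linear X by apply/asboolP.
apply/cvg_ex; exists (Dual lP); apply/cvgrPdist_le => e e0.
have e20 : 0 < e / 2 by rewrite divr_gt0.
have [u Fu] := cF _ e20; apply: filterS (Fu) => v uv.
rewrite -(subrK u (Dual lP)) -addrA (le_trans (ler_normD _ _))//.
rewrite [leRHS]splitr lerD// distrC dual_normE.
apply: dual_norm_le => x x1.
rewrite -[_ x]/(u x - l x) (le_trans (lle _ _ _ Fu))//.
by rewrite ler_piMr// ltW.
Qed.

HB.instance Definition _ := Uniform_isComplete.Build (dual X) dual_complete.

End dual_complete.

Section real_functions.
Context {R : realType}.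
Implicit Types phi psi : R -> R.

(* A function on [0, +oo[ is encoded by a function on R of which only the
   values on [0, +oo[ are used. *)
Definition admissible phi :=
  [/\ forall t, 0 <= t -> 0 <= phi t,
      forall s t, 0 <= s -> s <= t -> phi s <= phi t,
      phi 0 = 0 &
      forall u : R^nat, (forall n, 0 <= u n) ->
        phi (u n) @[n --> \oo] --> (0 : R) -> u @ \oo --> (0 : R)].

Definition strictly_convex_Rplus phi := forall s t l : R,
  0 <= s -> 0 <= t -> s != t -> 0 < l -> l < 1 ->
  phi (l * s + (1 - l) * t) < l * phi s + (1 - l) * phi t.

Definition differentiable_Rplus phi :=
  (forall t, 0 < t -> derivable phi t 1) /\
  cvg ((phi h - phi 0) / h @[h --> (0 : R)^'+]).

Definition deriv_Rplus phi (t : R) : R :=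
  if t == 0 then lim ((phi h - phi 0) / h @[h --> (0 : R)^'+])
  else derive1 phi t.

Local Open Scope ereal_scope.

(* The value at -oo is never used: the argument is a distance. *)
Definition extend_pinfty psi (t : \bar R) : \bar R :=
  match t with
  | r%:E => (psi r)%:E
  | +oo => lim ((psi s)%:E @[s --> +oo%R])
  | -oo => 0
  end.

End real_functions.

Section extended_functions.
Context {R : realType} {X : normedModType R}.
Local Open Scope ereal_scope.
Implicit Types (f g h : X -> \bar R) (A : set X) (u : dual X) (x : X).

Definition edom f : set X := [set x | f x < +oo].

Definition proper_fun f := edom f !=set0 /\ forall x, -oo < f x.

Definition tilt f u : X -> \bar R := fun x => f x - (u x)%:E.

Definition indic_infty A : X -> \bar R := fun x => if x \in A then 0 else +oo.

Definition epi f : set (X * R) := [set p | f p.1 <= p.2%:E].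

Definition closed_convex_hull (A : set (X * R)) : set (X * R) :=
  closure (smallest (@convex_set R (X * R)%type) A).

(* For g bounded below this is the function whose epigraph is the closed convex
   hull of the epigraph of g, see epi_convex_envelope. *)
Definition convex_envelope g : X -> \bar R := fun x =>
  ereal_inf [set a%:E | a in [set a : R | closed_convex_hull (epi g) (x, a)]].

Definition subdifferential h : X -> set (dual X) := fun x =>
  [set u | edom h x /\ forall y, (u (y - x)%R)%:E <= h y - h x].

(* If f (x_ u) = +oo then the right-hand side is -oo (as +oo - +oo = -oo), so
   that x_ u is forced to lie in the domain of f. *)
Definition SLWP (phi : R -> R) f (xbar : X) :=
  exists delta r tau kappa : R,
    [/\ (0 < delta)%R, (0 < r)%R, (0 < tau)%R, (0 < kappa)%R &
    exists x_ : dual X -> X, x_ 0%R = xbar /\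
      forall u, ball (0%R : dual X) delta u ->
        closed_ball xbar r (x_ u) /\
        forall x, closed_ball xbar r x ->
          (phi (kappa * `|x - x_ u|)%R)%:E <=
            tau%:E * (tilt f u x - tilt f u (x_ u))].

Definition dist_set x A : \bar R := ereal_inf [set `|x - a|%:E | a in A].

End extended_functions.

Section metric_regularity.
Context {R : realType} {X Y : completeNormedModType R}.
Implicit Types (psi : R -> R) (F : X -> set Y).

Definition set_inverse F (y : Y) : set X := [set x | F x y].

Definition strongly_metrically_regular psi F (xbar : X) (ybar : Y) :=
  [/\ admissible psi, F xbar ybar &
   exists r tau kappa delta : R,
    [/\ [/\ 0 < r, 0 < tau, 0 < kappa & 0 < delta],
      forall x y, ball xbar r x -> ball ybar r y ->
        (extend_pinfty psi (tau%:E * dist_set x (set_inverse F y)) <=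
           kappa%:E * dist_set y (F x))%E &
      forall y, ball ybar r y ->
        exists z, set_inverse F y `&` ball xbar delta = [set z]]].

End metric_regularity.

Section convex_envelope_epigraph.
Context {R : realType} {X : normedModType R}.
Local Notation cset := (@convex_set R (X * R)%type).
Implicit Types (A B : set (X * R)) (g : X -> \bar R).
Local Open Scope convex_scope.

Lemma sub_closed_convex_hull A : A `<=` closed_convex_hull A.
Proof. by apply: subset_trans (@subset_closure _ _); exact: sub_gen_smallest. Qed.

Lemma convex_smallest A : cset (smallest cset A).
Proof.
move=> x y l /set_mem sx /set_mem sy; apply/mem_set => B [cB AB].
by apply/set_mem/cB; apply/mem_set; [exact: sx|exact: sy].
Qed.

Lemma closed_convex_hull_sub A B :
  closed B -> cset B -> A `<=` B -> closed_convex_hull A `<=` B.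
Proof.
move=> clB cB AB; rewrite (closure_id B).1//; apply: closureS.
exact: smallest_sub.
Qed.

Lemma closed_convex_hull_epi_up g x a b : closed_convex_hull (epi g) (x, a) ->
  a <= b -> closed_convex_hull (epi g) (x, b).
Proof.
move=> gxa ab; pose T (p : X * R) : X * R := p + (0, b - a).
have cT : continuous T by move=> p; apply: cvgD => //; exact: cvg_cst.
suff : closed_convex_hull (epi g) `<=` T @^-1` closed_convex_hull (epi g).
  by move=> /(_ _ gxa); rewrite /T/= /GRing.add/= /add_pair/= addr0 addrC subrK.
have sT : smallest cset (epi g) `<=` T @^-1` smallest cset (epi g).
  apply: smallest_sub.
    move=> p q l /set_mem Tp /set_mem Tq; apply/mem_set.
    have /set_mem := convex_smallest l (mem_set Tp) (mem_set Tq).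
    congr (smallest _ _ _).
    rewrite /T /conv/= !scalerDr addrACA -scalerDl.
    by rewrite [l%:num + _]addrC subrK scale1r.
  move=> [y c] gyc; apply: sub_gen_smallest; rewrite /epi /T/= addr0.
  by rewrite (le_trans gyc)// lee_fin lerDl subr_ge0.
move=> p; rewrite /closed_convex_hull/= => clp B /cT /clp[q [sq Bq]].
by exists (T q); split => //; exact: sT.
Qed.

Lemma epi_convex_envelope g (m : R) : (forall x, m%:E <= g x)%E ->
  epi (convex_envelope g) = closed_convex_hull (epi g).
Proof.
move=> gm; have hm y a : closed_convex_hull (epi g) (y, a) -> m <= a.
  have := @closed_convex_hull_sub (epi g) [set p | m <= p.2].
  move=> /(_ _ _ _ (y, a)); apply.
  - apply: (@preimage_closed _ _ snd [set a : R | m <= a]); last exact: closed_ge.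
    by move=> p _; exact: cvg_snd.
  - move=> p q l /set_mem/= mp /set_mem/= mq; apply/mem_set => /=.
    rewrite -[m](convmm l (m : convex_lmodType R^o)).
    by rewrite lerD// /GRing.scale/= ler_wpM2l// subr_ge0.
  - by move=> [z c] /= gzc; rewrite -lee_fin (le_trans (gm z)).
apply/seteqP; split => -[y a] /=; last first.
  by move=> hya; apply: ereal_inf_lbound; exists a.
move=> hya; rewrite /closed_convex_hull (closure_id (closure _)).1; last first.
  exact: closed_closure.
move=> B /= -[/= [B1 B2] [/= B1y B2a] B12].
have /nbhs_ballP[e /= e0 aeB] := B2a.
have : (convex_envelope g y < (a + e / 2)%:E)%E.
  by rewrite (le_lt_trans hya)// lte_fin ltrDl divr_gt0.
move=> /ereal_inf_lt[_ [b hyb <-]]; rewrite lte_fin => /ltW bae.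
exists (y, a + e / 2); split; first exact: closed_convex_hull_epi_up hyb bae.
apply: B12; split; first exact: nbhs_singleton.
apply: aeB; rewrite -ball_normE /ball_/= opprD addNKr normrN gtr0_norm ?divr_gt0//.
by rewrite ltr_pdivrMr// ltr_pMr// ltr1n.
Qed.

End convex_envelope_epigraph.

(* Main.v *)
(* Let g := f + indicator of the ball, h its convex envelope and z := x_u.
   Convexity of phi gives phi (2 t) >= phi' t * t, and the affine functions of
   the norm tangent to phi pass from g to h, so that
     h x >= h z + <u, x - z> + phi' s * s / tau   with s := kappa * |x - z| / 2.
   Thus z is the only point where u is a subgradient of h; and for a subgradient
   v of h at x, adding h z >= h x + <v, z - x> yields
   phi' s * s / tau <= <v - u, x - z>, which is the regularity estimate. *)
Require Import Defs.
From HB Require Import structures.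
From mathcomp Require Import all_boot all_order all_algebra.
From mathcomp Require Import all_classical all_reals all_analysis.
From mathcomp Require Import ring lra.

Set Implicit Arguments.
Unset Strict Implicit.
Unset Printing Implicit Defensive.
Import Order.TTheory GRing.Theory Num.Theory.
Import numFieldNormedType.Exports.
Local Open Scope classical_set_scope.
Local Open Scope ring_scope.

(** * Supporting lines of a convex function on the half-line *)

Section convex_function.
Context {R : realType} (phi : R -> R).
Hypothesis phi_convex : strictly_convex_Rplus phi.
Hypothesis phi_derivable : forall t, 0 < t -> derivable phi t 1.

(** By convexity the difference quotient of [phi] at [s] in the direction [t - s] is at most
    [phi t - phi s] for steps [h] in ]0, 1[; let [h] tend to 0 from the right. *)
Lemma tangent_le (s t : R) : 0 < s -> 0 <= t ->
  phi s + derive1 phi s * (t - s) <= phi t.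
Proof.
move=> s0 t0; have [->|ts] := eqVneq t s; first by rewrite subrr mulr0 addr0.
have dphi : differentiable phi s by apply/derivable1_diffP; exact: phi_derivable.
rewrite addrC -lerBrDr mulrC.
have -> : (t - s) * derive1 phi s = 'D_(t - s) phi s.
  by rewrite deriveE// diff1E.
have /cvg_ex[l hl] : derivable phi s (t - s) by exact: diff_derivable.
rewrite /derive (cvg_lim _ hl)//.
have {}hl := cvg_dnbhs_at_right hl.
rewrite -(cvg_lim _ hl)//; apply: limr_le; first by apply/cvg_ex; exists l.
near=> h.
have h0 : 0 < h by [].
have h1 : h < 1 by near: h; exact: nbhs_right_lt.
rewrite /GRing.scale/= ler_pdivrMl//.
have := phi_convex t0 (ltW s0) ts h0 h1.
have -> : h * t + (1 - h) * s = h * (t - s) + s by ring.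
by move=> /ltW hle; rewrite lerBlDr (le_trans hle)//; lra.
Unshelve. all: by end_near. Qed.

End convex_function.

(** * Admissibility of the derivative *)

Section derivative_admissible.
Context {R : realType} (phi : R -> R).
Hypothesis phi_admissible : admissible phi.
Hypothesis phi_convex : strictly_convex_Rplus phi.
Hypothesis phi_differentiable : differentiable_Rplus phi.
Hypothesis deriv_phi0 : deriv_Rplus phi 0 = 0.

(** Otherwise the constant sequence [t] would have to tend to 0. *)
Lemma admissible_gt0 (t : R) : 0 < t -> 0 < phi t.
Proof.
case: phi_admissible => phi_ge0 _ _ phi_cvg t0.
rewrite lt_neqAle phi_ge0 ?(ltW t0)// andbT; apply/eqP => phit0.
have : (fun _ : nat => t) @ \oo --> (0 : R).
  by apply: phi_cvg => [_|]; [exact: ltW|rewrite -phit0; exact: cvg_cst].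
move=> /(cvg_lim (@norm_hausdorff _ _)); rewrite lim_cst// => t00.
by rewrite t00 ltxx in t0.
Qed.

Lemma deriv_Rplus_tangent_le (s t : R) : 0 <= s -> 0 <= t ->
  phi s + deriv_Rplus phi s * (t - s) <= phi t.
Proof.
case: phi_admissible => phi_ge0 _ phi0 _.
rewrite le_eqVlt => /predU1P[<-|s0] t0.
  by rewrite deriv_phi0 phi0 mul0r addr0 phi_ge0.
by rewrite /deriv_Rplus gt_eqF// tangent_le//; case: phi_differentiable.
Qed.

Lemma deriv_Rplus_gt0 (t : R) : 0 < t -> 0 < deriv_Rplus phi t.
Proof.
case: phi_admissible => _ _ phi0 _ t0.
(* The tangent at [t], evaluated at 0, gives [phi t <= deriv_Rplus phi t * t]. *)
have := deriv_Rplus_tangent_le (ltW t0) (lexx 0); rewrite phi0 => h.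
have pt := admissible_gt0 t0; rewrite -(pmulr_lgt0 _ t0); lra.
Qed.

Lemma deriv_Rplus_nondecreasing (s t : R) : 0 <= s -> s <= t ->
  deriv_Rplus phi s <= deriv_Rplus phi t.
Proof.
move=> s0; rewrite le_eqVlt => /predU1P[->//|st].
have t0 := le_lt_trans s0 st.
(* Adding the tangent inequalities at [s] and at [t] cancels the values of [phi]. *)
have h1 := deriv_Rplus_tangent_le s0 (ltW t0).
have h2 := deriv_Rplus_tangent_le (ltW t0) s0.
have ts0 : 0 < t - s by rewrite subr_gt0.
rewrite -(ler_pM2r ts0); lra.
Qed.

Lemma deriv_Rplus_ge0 (t : R) : 0 <= t -> 0 <= deriv_Rplus phi t.
Proof. by move=> t0; rewrite -deriv_phi0 deriv_Rplus_nondecreasing. Qed.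

Lemma admissible_deriv_Rplus : admissible (deriv_Rplus phi).
Proof.
split => [|||u u0 du]; [exact: deriv_Rplus_ge0|exact: deriv_Rplus_nondecreasing
  |exact: deriv_phi0|].
apply/cvgrPdist_lt => e e0.
(* The threshold is the derivative at [e], which is positive: by monotonicity, a smaller derivative
   at [u n] forces [u n < e]. *)
move/cvgrPdist_lt : du => /(_ _ (deriv_Rplus_gt0 e0)).
apply: filterS => n /=; rewrite !sub0r !normrN !ger0_norm ?deriv_Rplus_ge0//.
apply: contraTT; rewrite -!leNgt => eu.
by rewrite deriv_Rplus_nondecreasing// ltW.
Qed.

End derivative_admissible.

(** * Comparison of a function with its closed convex envelope *)

Section convex_envelope_bounds.
Context {R : realType} {X : normedModType R}.
Local Open Scope ereal_scope.
Implicit Types (g : X -> \bar R) (x : X).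

Lemma convex_envelope_le g x : convex_envelope g x <= g x.
Proof.
have h (a : R) : g x <= a%:E -> convex_envelope g x <= a%:E.
  move=> gxa; apply: ereal_inf_lbound; exists a => //=.
  exact: sub_closed_convex_hull.
case: (g x) h => [a h|h|h]; first exact: h.
- by rewrite leey.
- by rewrite leeNy_eq; apply/eqP/eq_ninfty => a; exact: h (leNye _).
Qed.

(** The epigraph of [w] is closed, convex and contains that of [g], hence also its closed convex
    hull. *)
Lemma convex_envelope_ge g (w : X -> R) : continuous w ->
  (forall x y (l : R), (0 <= l <= 1)%R ->
    (w (l *: x + (1 - l) *: y) <= l * w x + (1 - l) * w y)%R) ->
  (forall x, (w x)%:E <= g x) -> forall x, (w x)%:E <= convex_envelope g x.
Proof.
move=> cw convw wg x; apply: le_ereal_inf_tmp => _ [a /= xa <-]; rewrite lee_fin.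
move: xa; apply: (@closed_convex_hull_sub _ _ _
  [set p : X * R | (w p.1 <= p.2)%R] _ _ _ (x, a)).
- rewrite (_ : [set p | _] = (fun p : X * R => p.2 - w p.1)%R @^-1`
      [set b | (0 <= b)%R]); last first.
    by apply/seteqP; split => p /=; rewrite subr_ge0.
  apply: preimage_closed; last exact: closed_ge.
  move=> p _; apply: cvgB; first exact: cvg_snd.
  by apply: (@cvg_comp _ _ _ fst w); [exact: cvg_fst|exact: cw].
- move=> p q l /set_mem/= wp /set_mem/= wq; apply/mem_set => /=.
  apply: le_trans (convw _ _ _ _) _; first by rewrite ge0 le1.
  by rewrite lerD// ler_wpM2l// subr_ge0.
- by move=> [y b] /= gyb; rewrite -lee_fin (le_trans (wg y)).
Qed.

End convex_envelope_bounds.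

(** Since [+oo - +oo] is [-oo], an infinite [g z] would make the right-hand side [-oo]. *)
Lemma tilt_ge0_fin_num {R : realType} {X : normedModType R} (g : X -> \bar R)
    (u : dual X) (z : X) (tau c : R) : (-oo < g z)%E -> 0 < tau ->
  (c%:E <= tau%:E * (tilt g u z - tilt g u z))%E -> g z \is a fin_num.
Proof.
by rewrite /tilt; case: (g z) => //= _ t0; rewrite gt0_muleNy ?lte_fin.
Qed.

(** * Consequences of a global growth condition for one fixed tilt *)

Section growth.
Context {R : realType} {X : normedModType R} (phi : R -> R).
Hypothesis phi_admissible : admissible phi.
Hypothesis phi_convex : strictly_convex_Rplus phi.
Hypothesis phi_differentiable : differentiable_Rplus phi.
Hypothesis deriv_phi0 : deriv_Rplus phi 0 = 0.
Variables (g : X -> \bar R) (u : dual X) (z : X) (tau kappa : R).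
Hypothesis g_gtNy : forall x, (-oo < g x)%E.
Hypothesis tau_gt0 : 0 < tau.
Hypothesis kappa_gt0 : 0 < kappa.
Hypothesis g_growth : forall x,
  ((phi (kappa * `|x - z|))%:E <= tau%:E * (tilt g u x - tilt g u z))%E.

Let rho := kappa / 2.
Let rho_gt0 : 0 < rho. Proof. by rewrite divr_gt0. Qed.

Lemma growth_fin_num : g z \is a fin_num.
Proof. exact: tilt_ge0_fin_num (g_gtNy z) tau_gt0 (g_growth z). Qed.

Lemma growth_ge x :
  ((fine (g z) + u (x - z) + tau^-1 * phi (kappa * `|x - z|))%:E <= g x)%E.
Proof.
have := g_growth x; have := g_gtNy x; rewrite /tilt -(fineK growth_fin_num).
case: (g x) => [a|_ _|//]; last by rewrite leey.
rewrite /= !EFinN -!EFinB -EFinM !lee_fin linearB/= => _.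
by rewrite -ler_pdivrMl//; lra.
Qed.

(* The minorant is a tangent of phi composed with the norm, so its epigraph is
   closed and convex; touching at half the distance turns phi into phi'. *)
Lemma growth_envelope_ge x :
  ((fine (g z) + u (x - z) +
    tau^-1 * (deriv_Rplus phi (rho * `|x - z|) * (rho * `|x - z|)))%:E
   <= convex_envelope g x)%E.
Proof.
set s := rho * `|x - z|; set d := deriv_Rplus phi s.
have s0 : 0 <= s by rewrite mulr_ge0// ltW.
have d0 : 0 <= d by exact: deriv_Rplus_ge0.
have ti0 : 0 <= tau^-1 by rewrite invr_ge0 ltW.
pose w (y : X) : R :=
  fine (g z) + u (y - z) + tau^-1 * (d * (kappa * `|y - z| - s)).
have -> : fine (g z) + u (x - z) + tau^-1 * (d * s) = w x.
  (* As [rho] is half of [kappa], [kappa] times the distance from [x] to [z] is [2 * s]. *)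
  by rewrite /w (_ : kappa * `|x - z| - s = s)// /s /rho; field.
apply: convex_envelope_ge => [y|y y' l /andP[l0 l1]|y].
- have cz : (fun y : X => y - z) @ y --> y - z.
    by apply: cvgB; [exact: cvg_id|exact: cvg_cst].
  apply: cvgD.
    apply: cvgD; first exact: cvg_cst.
    by apply: (@cvg_comp _ _ _ (fun y : X => y - z) u _ _ _ cz); exact: (dualP u).2.
  apply: cvgMl_tmp; apply: cvgMl_tmp; apply: cvgB; last exact: cvg_cst.
  by apply: cvgMl_tmp; exact: cvg_norm.
- have e : l *: y + (1 - l) *: y' - z = l *: (y - z) + (1 - l) *: (y' - z).
    by rewrite !scalerBr addrACA -opprD -scalerDl [l + _]addrC subrK scale1r.
  rewrite /w e linearD !linearZ/=.
  have : `|l *: (y - z) + (1 - l) *: (y' - z)| <=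
         l * `|y - z| + (1 - l) * `|y' - z|.
    rewrite (le_trans (ler_normD _ _))// !normrZ !ger0_norm//.
    by rewrite subr_ge0.
  have c0 : 0 <= tau^-1 * d * kappa by rewrite !mulr_ge0// ltW.
  by move=> /(ler_wpM2l c0); rewrite /GRing.scale/=; lra.
- apply: le_trans (growth_ge y); rewrite lee_fin lerD2l ler_wpM2l//.
  have t0 : 0 <= kappa * `|y - z| by rewrite mulr_ge0// ltW.
  (* The minorant [w] omits the constant term [phi s] of the tangent, which is nonnegative. *)
  apply: le_trans (deriv_Rplus_tangent_le phi_admissible phi_convex
    phi_differentiable deriv_phi0 s0 t0).
  by case: phi_admissible => phi_ge0 _ _ _; rewrite lerDr phi_ge0.
Qed.

Lemma growth_envelope_eq : convex_envelope g z = g z.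
Proof.
apply/eqP; rewrite eq_le convex_envelope_le/=.
have := growth_envelope_ge z.
by rewrite subrr linear0 normr0 !mulr0 !addr0 fineK// growth_fin_num.
Qed.

Lemma growth_subdifferential : subdifferential (convex_envelope g) z u.
Proof.
rewrite /subdifferential /edom /= growth_envelope_eq.
split; first by rewrite ltey_eq growth_fin_num.
move=> y; rewrite leeBrDr ?growth_fin_num//.
apply: le_trans (growth_envelope_ge y).
rewrite -(fineK growth_fin_num) -EFinD lee_fin addrC lerDl.
have s0 : 0 <= rho * `|y - z| by rewrite mulr_ge0// ltW.
apply: mulr_ge0; first by rewrite invr_ge0 ltW.
by apply: mulr_ge0 => //; exact: deriv_Rplus_ge0.
Qed.

Lemma growth_regular x (v : dual X) : subdifferential (convex_envelope g) x v ->
  deriv_Rplus phi (rho * `|x - z|) <= tau / rho * `|u - v|.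
Proof.
have [->|xz] := eqVneq x z.
  rewrite subrr normr0 mulr0 deriv_phi0 => _.
  by rewrite mulr_ge0// divr_ge0// ltW.
have nxz : 0 < `|x - z| by rewrite normr_gt0 subr_eq0.
move=> [xdom /(_ z)]; have := growth_envelope_ge x.
move: xdom; rewrite /edom/= growth_envelope_eq -(fineK growth_fin_num).
case: (convex_envelope g x) => [a _|//|_]; last by rewrite leeNy_eq.
rewrite -EFinB !lee_fin => h1 h2.
have h3 : v (x - z) - u (x - z) <= `|u - v| * `|x - z|.
  by rewrite distrC; exact: le_trans (ler_norm _) (dual_le (v - u) (x - z)).
move: h2; rewrite -(opprB x z) linearN/= => h2.
set d := deriv_Rplus _ _ in h1 *.
(* Summing [h1] and [h2] cancels [a] and [g z]; [h3] bounds the remaining linear terms. *)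
have : tau^-1 * (d * (rho * `|x - z|)) <= `|u - v| * `|x - z| by lra.
rewrite ler_pdivrMl// => h4.
rewrite -(ler_pM2r nxz) -(ler_pM2l rho_gt0) mulrCA (le_trans h4)//.
rewrite [leRHS]mulrA [rho * _]mulrA [rho * _]mulrC divfK ?gt_eqF//.
by rewrite mulrA.
Qed.

(** With [v = u] the estimate of [growth_regular] has right-hand side 0, while the derivative is
    positive away from 0. *)
Lemma growth_inverse :
  [set x | subdifferential (convex_envelope g) x u] = [set z].
Proof.
apply/seteqP; split => x /=; last by move=> ->; exact: growth_subdifferential.
move=> /growth_regular; rewrite subrr normr0 mulr0; apply: contraPP => /eqP xz.
apply/negP; rewrite -ltNge deriv_Rplus_gt0// mulr_gt0// normr_gt0 subr_eq0//.
Qed.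

End growth.

Theorem theorem3p4 (R : realType) (X : completeNormedModType R)
    (phi : R -> R) (f : X -> \bar R) (xbar : X)
    (phi_admissible : admissible phi)
    (phi_strictly_convex : strictly_convex_Rplus phi)
    (phi_differentiable : differentiable_Rplus phi)
    (deriv_phi0 : deriv_Rplus phi 0 = 0)
    (f_proper : proper_fun f)
    (f_lsc : lower_semicontinuous f)
    (xbar_dom : edom f xbar)
    (f_SLWP : SLWP phi f xbar) :
  exists r : R, 0 < r /\
    strongly_metrically_regular (deriv_Rplus phi)
      (subdifferential
        (convex_envelope (fun x => f x + indic_infty (closed_ball xbar r) x)%E))
      xbar (0 : dual X).
Proof.
have [delta [r [tau [kappa [delta0 r0 tau0 kappa0 [x_ [x_0 x_P]]]]]]] := f_SLWP.
exists r; split => //.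
set g := (X in convex_envelope X).
have gB x : closed_ball xbar r x -> g x = f x.
  by move=> xB; rewrite /g /indic_infty mem_set// adde0.
have gNB x : ~ closed_ball xbar r x -> g x = +oo%E.
  move=> xB; rewrite /g /indic_infty memNset// addey// gt_eqF//.
  exact: f_proper.2.
have g_gtNy x : (-oo < g x)%E.
  by have [/gB ->|/gNB ->//] := pselect (closed_ball xbar r x); exact: f_proper.2.
(* The indicator makes the local condition global: outside the ball [g] is [+oo], while [g (x_ u)]
   is finite. *)
have growth u : ball (0 : dual X) delta u -> forall x,
    ((phi (kappa * `|x - x_ u|))%:E <= tau%:E * (tilt g u x - tilt g u (x_ u)))%E.
  move=> /x_P[xuB xuP] x.
  have [xB|xB] := pselect (closed_ball xbar r x).
    by rewrite /tilt !gB//; exact: xuP.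
  have fxu : f (x_ u) \is a fin_num.
    exact: tilt_ge0_fin_num (f_proper.2 _) tau0 (xuP _ xuB).
  rewrite /tilt gNB// gB// -(fineK fxu).
  by rewrite /= gt0_muley ?lte_fin// leey.
have delta00 : ball (0 : dual X) delta 0 by exact: ballxx.
split.
- exact: admissible_deriv_Rplus.
- have := growth 0 delta00; rewrite x_0; exact: growth_subdifferential.
(* The middle constants are those of [growth_regular]; the open ball of radius [r + r] contains the
   closed ball of radius [r] where every [x_ u] lies. *)
exists delta, (kappa / 2), (tau / (kappa / 2)), (r + r); split.
- by split=> //; rewrite ?divr_gt0// addr_gt0.
- move=> x u _ uB.
  rewrite /set_inverse (growth_inverse _ _ _ _ g_gtNy tau0 kappa0 (growth u uB))//.
  (* The inverse image is the singleton of [x_ u], so this distance is a real number. *)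
  rewrite /dist_set image_set1 ereal_inf1/=.
  have c0 : 0 < tau / (kappa / 2) by rewrite !divr_gt0.
  (* Bounding the infimum from below over all subgradients [v] also covers points without any. *)
  rewrite -lee_pdivrMl//; apply: le_ereal_inf_tmp => _ [v xv <-].
  rewrite -EFinM lee_fin ler_pdivrMl//.
  exact: growth_regular (growth u uB) x v xv.
- move=> u uB; exists (x_ u).
  rewrite /set_inverse (growth_inverse _ _ _ _ g_gtNy tau0 kappa0 (growth u uB))//.
  apply/setIidPl => _ ->.
  have [+ _] := x_P u uB; rewrite closed_ballE// /closed_ball_/= => xu.
  by rewrite -ball_normE /ball_/= (le_lt_trans xu)// ltrDl.
Qed.
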